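(* Let $f:\{0,1\}^n\to\{0,1\}^n$ be a Boolean network such that the interaction graph $G(f)$ has no negative loop. Then there exists a monotone Boolean network $f':\{0,1\}^{2n}\to\{0,1\}^{2n}$ such that: (i) for every $x\in\{0,1\}^n$, $x$ is a fixed point of $f$ if and only if $(x,\overline{x})$ is a fixed point of $f'$; and (ii) for all $x,y\in\{0,1\}^n$ and every integer $\ell\geq 0$, $\Gamma(f)$ has a path from $x$ to $y$ of length $\ell$ if and only if $\Gamma(f')$ has a path from $(x,\overline{x})$ to $(y,\overline{y})$ of length $2\ell$.
   Context: A Boolean network is a map $f:\{0,1\}^n\to\{0,1\}^n$, $x\mapsto (f_1(x),\dots,f_n(x))$; it is monotone if $x\leq y$ (componentwise) implies $f(x)\leq f(y)$. $G(f)$ has a negative loop on vertex $i$ if there exists $x\in\{0,1\}^n$ with $f_i(x_1,\dots,x_{i-1},1,x_{i+1},\dots,x_n)<f_i(x_1,\dots,x_{i-1},0,x_{i+1},\dots,x_n)$; ''no negative loop'' means this happens for no $i\in[n]$. The asynchronous graph $\Gamma(f)$ has vertex set $\{0,1\}^n$ and an arc from $x$ to $y$ whenever there is $i$ with $f_i(x)=y_i\neq x_i$ and $y_j=x_j$ for all $j\neq i$; the length of a path is its number of arcs. For $x\in\{0,1\}^n$, $\overline{x}$ is obtained by complementing every component, and for $x,y\in\{0,1\}^n$, $(x,y)\in\{0,1\}^{2n}$ denotes the concatenation. *)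

(* Defs.v *)
From mathcomp Require Import all_boot.
Set Implicit Arguments.
Unset Strict Implicit.
Unset Printing Implicit Defensive.

Definition config (n : nat) := {ffun 'I_n -> bool}.

Definition le_config n (x y : config n) : Prop := forall i : 'I_n, x i <= y i.

Definition monotone n (f : config n -> config n) : Prop :=
  forall x y : config n, le_config x y -> le_config (f x) (f y).

Definition set_comp n (x : config n) (i : 'I_n) (b : bool) : config n :=
  [ffun j => if j == i then b else x j].

Definition negative_loop n (f : config n -> config n) (i : 'I_n) : Prop :=
  exists x : config n, f (set_comp x i true) i < f (set_comp x i false) i.

Definition async n (f : config n -> config n) : rel (config n) :=
  fun x y => [exists i : 'I_n,
    [&& f x i == y i, y i != x i & [forall j : 'I_n, (j != i) ==> (y j == x j)]]].

(* Vertices may repeat along a path; p lists the vertices after x, so its size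
   is the number of arcs. *)
Definition has_path (T : eqType) (e : rel T) (x y : T) (l : nat) : Prop :=
  exists p : seq T, [/\ path e x p, last x p = y & size p = l].

Definition compl_config n (x : config n) : config n := [ffun i => ~~ x i].

Definition cat_config n m (x : config n) (y : config m) : config (n + m) :=
  [ffun k : 'I_(n + m) =>
    match split k with inl i => x i | inr j => y j end].

(* Main.v *)
Require Import Defs.
From mathcomp Require Import all_boot.

(** Idea. In a state (x, y), call an index j high if x_j = y_j = 1 and low if
    x_j = y_j = 0; the states (x, ~x) are those with no high and no low index.
    The components i and n + i of the monotone network look at the indices
    other than i: they are 0 if one of them is low, otherwise 1 if one of them
    is high, and otherwise f_i(x) and ~ f_i(~y).  From (x, ~x), updating i or
    n + i makes i high or low.  As i is not a negative loop, the value of f_i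
    is the same at x and at x with x_i flipped, so the only way to get i out of
    that status is to update the other of the two components, which completes
    a transition of f.  Updating any other index instead gives it the same
    status as i, after which all components are forced to the same value for
    ever and no state (y, ~y) is reachable. *)

Set Implicit Arguments.
Unset Strict Implicit.
Unset Printing Implicit Defensive.

(** * Asynchronous arcs as coordinate flips *)

Definition flip n (x : config n) (i : 'I_n) : config n := set_comp x i (~~ x i).

Lemma flip_at n (x : config n) i : flip x i i = ~~ x i.
Proof. by rewrite ffunE eqxx. Qed.

Lemma flip_off n (x : config n) i j : j != i -> flip x i j = x j.
Proof. by move=> ji; rewrite ffunE (negPf ji). Qed.

Lemma asyncP n (f : config n -> config n) x y :
  reflect (exists2 i, f x i != x i & y = flip x i) (async f x y).
Proof.
apply: (iffP existsP) => [[i /and3P[/eqP fy yx /forallP offi]]|[i fx ->]].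
  exists i; first by rewrite fy.
  apply/ffunP => j; have := offi j; rewrite ffunE.
  case: eqVneq => [-> _|_ /eqP //].
  by case: (y i) yx; case: (x i).
exists i; rewrite flip_at; apply/and3P; split.
- by case: (f x i) fx; case: (x i).
- by case: (x i).
- by apply/forallP => j; apply/implyP => ji; rewrite flip_off.
Qed.

Lemma flip_compl n (x : config n) i :
  flip (compl_config x) i = compl_config (flip x i).
Proof.
by apply/ffunP => j; rewrite !ffunE; case: eqVneq => // ->; rewrite ffunE.
Qed.

Lemma eq_flip n (x y : config n) i :
  (forall j, j != i -> x j = y j) -> x i != y i -> flip x i = y.
Proof.
move=> offi xy; apply/ffunP => j; have [->|ji] := eqVneq j i.
  by rewrite flip_at; case: (x i) xy; case: (y i).
by rewrite flip_off ?offi.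
Qed.

Lemma cat_configl n m (x : config n) (y : config m) i :
  cat_config x y (lshift m i) = x i.
Proof. by rewrite ffunE -[lshift m i]/(unsplit (inl i)) unsplitK. Qed.

Lemma cat_configr n m (x : config n) (y : config m) i :
  cat_config x y (rshift n i) = y i.
Proof. by rewrite ffunE -[rshift n i]/(unsplit (inr i)) unsplitK. Qed.

Definition cat_configE := (cat_configl, cat_configr).

Lemma flip_catl n m (x : config n) (y : config m) i :
  flip (cat_config x y) (lshift m i) = cat_config (flip x i) y.
Proof.
apply/ffunP => k; case: (split_ordP k) => j ->;
  by rewrite ffunE !cat_configE ?eq_rlshift ?ffunE // (inj_eq (@lshift_inj _ _)).
Qed.

Lemma flip_catr n m (x : config n) (y : config m) i :
  flip (cat_config x y) (rshift n i) = cat_config x (flip y i).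
Proof.
apply/ffunP => k; case: (split_ordP k) => j ->;
  by rewrite ffunE !cat_configE ?eq_lrshift ?ffunE // (inj_eq (@rshift_inj _ _)).
Qed.

(** * Local monotonicity from the absence of negative loops *)

Lemma no_negative_loop_mono n (f : config n -> config n) (i : 'I_n) (x y : config n) :
  ~ negative_loop f i -> (forall j, j != i -> x j = y j) ->
  (x i ==> y i) -> (f x i ==> f y i).
Proof.
move=> nl offi xy; case: (eqVneq (x i) (y i)) => [xyi|nxy].
  suff -> : x = y by apply: implybb.
  by apply/ffunP => j; have [->|/offi] := eqVneq j i.
have xE : x = set_comp x i false.
  by apply/ffunP => j; rewrite ffunE; case: eqVneq => // ->;
     case: (x i) (y i) xy nxy => [] [].
have yE : y = set_comp x i true.
  apply/ffunP => j; rewrite ffunE; case: eqVneq => [->|/offi //].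
  by case: (x i) (y i) xy nxy => [] [].
apply/implyP => fx; apply/negPn/negP => fy; apply: nl; exists x.
by rewrite -yE -xE fx (negPf fy).
Qed.

(** If [x i] is 0, then [f x i] is 1 and raising coordinate [i] cannot lower it; the case where
    [x i] is 1 is dual. *)
Lemma no_negative_loop_flip n (f : config n -> config n) (i : 'I_n) (x : config n) :
  ~ negative_loop f i -> f x i != x i -> f (flip x i) i = f x i.
Proof.
move=> nl fx.
have := @no_negative_loop_mono _ f i x (flip x i) nl.
have := @no_negative_loop_mono _ f i (flip x i) x nl.
rewrite flip_at => /(_ (fun j => @flip_off _ x i j)) h1.
move=> /(_ (fun j ji => esym (@flip_off _ x i j ji))) h2.
by move: fx h1 h2; case: (f x i) (x i) (f (flip x i) i) => [] [] [] //= _ H1 H2;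
  first [by have := H1 isT | by have := H2 isT].
Qed.

(** * The lifted network and its monotonicity *)

Definition lhalf n m (z : config (n + m)) : config n := [ffun i => z (lshift m i)].
Definition rhalf n m (z : config (n + m)) : config m := [ffun i => z (rshift n i)].

Lemma lhalf_cat n m (x : config n) (y : config m) : lhalf (cat_config x y) = x.
Proof. by apply/ffunP => i; rewrite ffunE cat_configl. Qed.

Lemma rhalf_cat n m (x : config n) (y : config m) : rhalf (cat_config x y) = y.
Proof. by apply/ffunP => i; rewrite ffunE cat_configr. Qed.

Lemma compl_configK n : involutive (@compl_config n).
Proof. by move=> x; apply/ffunP => i; rewrite !ffunE negbK. Qed.

(** A low index takes precedence over a high one. Both tests are monotone in [z], hence so is the
    value for fixed [b]. *)
Definition guard n (z : config (n + n)) (i : 'I_n) (b : bool) : bool :=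
  [forall j, (j != i) ==> (z (lshift n j) || z (rshift n j))] &&
  ([exists j, (j != i) && (z (lshift n j) && z (rshift n j))] || b).

Definition lift_net n (f : config n -> config n) (z : config (n + n)) :
    config (n + n) :=
  cat_config [ffun i => guard z i (f (lhalf z) i)]
             [ffun i => guard z i (~~ f (compl_config (rhalf z)) i)].

Definition diag n (x : config n) : config (n + n) := cat_config x (compl_config x).

Lemma leb_implyb (a b : bool) : (a <= b) = (a ==> b).
Proof. by case: a b => [] []. Qed.

(** The inner values need comparing only where they decide. If the left guard is 1 through [b] and
    [z'] has no high index off [i], then each such index carries exactly one 1 in [z] and in [z'],
    so [le_config z z'] forces equality there. *)
Lemma guard_mono n (z z' : config (n + n)) i (b b' : bool) :
  le_config z z' ->
  ((forall j, j != i ->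
      z (lshift n j) = z' (lshift n j) /\ z (rshift n j) = z' (rshift n j)) ->
   b ==> b') ->
  guard z i b ==> guard z' i b'.
Proof.
move=> zz' bb'; apply/implyP => /andP[/forallP nolow hib].
have zl j : z (lshift n j) ==> z' (lshift n j) by rewrite -leb_implyb.
have zr j : z (rshift n j) ==> z' (rshift n j) by rewrite -leb_implyb.
apply/andP; split.
  apply/forallP => j; apply/implyP => ji; have := implyP (nolow j) ji.
  by case/orP => h; [rewrite (implyP (zl j)) | rewrite (implyP (zr j)) ?orbT].
case: existsP => //= nohi.
case/orP: hib => [/existsP[j /and3P[ji hl hr]]|].
  by case: nohi; exists j; rewrite ji (implyP (zl j)) ?(implyP (zr j)).
apply/implyP/bb' => j ji; have := implyP (nolow j) ji.
have : ~~ (z' (lshift n j) && z' (rshift n j)).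
  by apply/negP => h; apply: nohi; exists j; rewrite ji.
move: (zl j) (zr j).
by case: (z _) (z _) (z' _) (z' _) => [] [] [] [].
Qed.

Lemma lift_net_monotone n (f : config n -> config n) :
  (forall i, ~ negative_loop f i) -> monotone (lift_net f).
Proof.
move=> nl z z' zz' k; case: (split_ordP k) => i ->;
  rewrite !cat_configE !ffunE leb_implyb; apply: guard_mono => // offi.
- apply: no_negative_loop_mono => //; last by rewrite !ffunE -leb_implyb.
  by move=> j /offi[h _]; rewrite !ffunE.
(* Component n + i complements both the argument and the value of [f]; the two order reversals
   cancel. *)
- rewrite implybNN; apply: no_negative_loop_mono => //.
    by move=> j /offi[_ h]; rewrite !ffunE h.
  by rewrite !ffunE implybNN -leb_implyb.
Qed.

(** * Forced guards and trapped states *)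

Lemma guard_id n (z : config (n + n)) i b :
  (forall j, j != i -> z (lshift n j) = ~~ z (rshift n j)) -> guard z i b = b.
Proof.
move=> offi; rewrite /guard (_ : [forall j, _] = true).
  rewrite (_ : [exists j, _] = false) //; apply/existsP => -[j /and3P[/offi ->]].
  by case: (z _).
by apply/forallP => j; apply/implyP => /offi ->; rewrite orNb.
Qed.

(** Since low wins over high, forcing the value 1 requires in addition that no index be low. *)
Lemma guard_const n (z : config (n + n)) i j b c : j != i ->
  z (lshift n j) = b -> z (rshift n j) = b ->
  (b -> forall k, z (lshift n k) || z (rshift n k)) -> guard z i c = b.
Proof.
move=> ji zl zr; case: b zl zr => zl zr nolow; rewrite /guard.
  rewrite (_ : [exists j, _] = true) ?andbT.
    by apply/forallP => k; apply/implyP => _; apply: nolow.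
  by apply/existsP; exists j; rewrite ji zl zr.
by apply/negbTE; rewrite negb_and negb_forall; apply/orP; left;
   apply/existsP; exists j; rewrite ji zl zr.
Qed.

(** Quantifying over [c] makes the notion independent of the network: all components of any
    [lift_net f] are forced to [b]. *)
Definition trapped n (b : bool) (z : config (n + n)) : Prop :=
  forall i c, guard z i c = b.

(** An arc can only set a coordinate to [b], so the state moves monotonically towards [b], and
    [guard_mono] keeps every guard at [b]. *)
Lemma trapped_step n (f : config n -> config n) b z z' :
  trapped b z -> async (lift_net f) z z' -> trapped b z'.
Proof.
move=> tz /asyncP[k fk ->] i c; have {fk} zk : z k = ~~ b.
  move: fk; case: (split_ordP k) => j ->; rewrite !cat_configE ffunE tz;
  by case: b {tz}; case: (z _).
case: b tz zk => tz /= zk.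
  suff : guard z i c ==> guard (flip z k) i c by rewrite tz.
  apply: guard_mono => [j|_]; last exact: implybb.
  by rewrite ffunE; case: eqVneq => // ->; rewrite zk.
apply/negbTE; suff : guard (flip z k) i c ==> guard z i c by rewrite tz implybF.
apply: guard_mono => [j|_]; last exact: implybb.
by rewrite ffunE; case: eqVneq => // ->; rewrite zk.
Qed.

Lemma trapped_path n (f : config n -> config n) b z p :
  trapped b z -> path (async (lift_net f)) z p -> trapped b (last z p).
Proof.
elim: p z => //= z' p IH z tz /andP[zz']; apply: IH.
exact: trapped_step zz'.
Qed.

(** On the diagonal a guard returns its inner value, here chosen to be [~~ b]. The index [i]
    excludes n = 0, where [trapped] holds vacuously. *)
Lemma trapped_diag n (x : config n) b (i : 'I_n) : ~ trapped b (diag x).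
Proof.
move=> /(_ i (~~ b)); rewrite guard_id; first by case: b.
by move=> j _; rewrite !cat_configE ffunE negbK.
Qed.

(** * Two steps from a diagonal state *)

Lemma lift_net_lshift n (f : config n -> config n) (a c : config n) (i : 'I_n) :
  (forall j, j != i -> a j = c j) ->
  lift_net f (cat_config a (compl_config c)) (lshift n i) = f a i.
Proof.
move=> offi; rewrite cat_configl ffunE lhalf_cat guard_id // => j ji.
by rewrite !cat_configE ffunE negbK offi.
Qed.

Lemma lift_net_rshift n (f : config n -> config n) (a c : config n) (i : 'I_n) :
  (forall j, j != i -> a j = c j) ->
  lift_net f (cat_config a (compl_config c)) (rshift n i) = ~~ f c i.
Proof.
move=> offi; rewrite cat_configr ffunE rhalf_cat compl_configK guard_id // => j ji.
by rewrite !cat_configE ffunE negbK offi.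
Qed.

Lemma lift_net_diag n (f : config n -> config n) x :
  lift_net f (diag x) = diag (f x).
Proof.
apply/ffunP => k; case: (split_ordP k) => i ->.
  by rewrite lift_net_lshift // cat_configl.
by rewrite lift_net_rshift // cat_configr ffunE.
Qed.

(** Index [i] is high if [a i] is 1 and low otherwise. Flipping its first copy gives [diag c], its
    second [diag a]; as [f a i = f c i], exactly one of these arcs exists. Any other index that
    moves acquires the status of [i], so each index has another one with that status and all guards
    equal [a i]. *)
Lemma lift_net_second_step n (f : config n -> config n) (a c : config n) (i : 'I_n) z :
  (forall j, j != i -> a j = c j) -> a i != c i -> f a i = f c i ->
  async (lift_net f) (cat_config a (compl_config c)) z ->
  z = diag (if a i == f a i then a else c) \/ trapped (a i) z.
Proof.
move=> offi ac fac.
(* The side condition of [guard_const]: if [i] is high then no index is low, the others being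
   complementary. *)
have lowfree : a i -> forall k, a k || ~~ c k.
  move=> ai k; have [->|/offi ->] := eqVneq k i; first by rewrite ai.
  by rewrite orbN.
have ci : ~~ c i = a i by case: (a i) (c i) ac => [] [].
have G j d : j != i -> guard (cat_config a (compl_config c)) j d = a i.
  move=> ji; apply: (@guard_const _ _ j i); rewrite ?cat_configE ?ffunE 1?eq_sym //.
  by move=> ai k; rewrite !cat_configE ffunE; apply: lowfree ai k.
case/asyncP => k fk ->; move: fk; case: (split_ordP k) => j ->.
- have [->|ji] := eqVneq j i.
    rewrite lift_net_lshift // cat_configl => fa; left.
    by rewrite flip_catl (eq_flip offi ac) eq_sym (negPf fa).
  rewrite !cat_configl ffunE G // => aij; right => l d.
  have aj : a j = ~~ a i by case: (a i) (a j) aij => [] [].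
  (* The index forcing the guard of [l] must differ from [l]: it is [j] when [l] is [i], and [i]
     otherwise. *)
  have [li|li] := eqVneq l i.
    apply: (@guard_const _ _ l j); rewrite ?li // flip_catl ?cat_configE.
    + by rewrite flip_at aj negbK.
    + by rewrite ffunE -offi // aj negbK.
    move=> ai k'; rewrite !cat_configE !ffunE.
    case: eqVneq => [->|_]; first by rewrite aj ai.
    exact: lowfree ai k'.
  apply: (@guard_const _ _ l i); rewrite 1?eq_sym // flip_catl ?cat_configE.
  + by rewrite flip_off // eq_sym.
  + by rewrite ffunE.
  move=> ai k'; rewrite !cat_configE !ffunE.
  case: eqVneq => [->|_]; first by rewrite aj ai.
  exact: lowfree ai k'.
- have [->|ji] := eqVneq j i.
    rewrite lift_net_rshift // cat_configr ffunE => fa; left.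
    rewrite flip_catr flip_compl (@eq_flip _ c a); first 1 last.
    + by move=> l li; rewrite offi.
    + by rewrite eq_sym.
    suff -> : a i == f a i by [].
    by rewrite fac; case: (f c i) (c i) (a i) fa ac => [] [] [].
  rewrite !cat_configr !ffunE G // => aij; right => l d.
  have cj : c j = a i by case: (a i) (c j) aij => [] [].
  have aj : a j = a i by rewrite offi.
  have [li|li] := eqVneq l i.
    apply: (@guard_const _ _ l j); rewrite ?li // flip_catr ?cat_configE //.
    + by rewrite flip_at ffunE negbK.
    move=> ai k'; rewrite !cat_configE flip_compl !ffunE.
    case: eqVneq => [->|_]; first by rewrite aj ai.
    exact: lowfree ai k'.
  apply: (@guard_const _ _ l i); rewrite 1?eq_sym // flip_catr ?cat_configE //.
  + by rewrite flip_off ?ffunE // eq_sym.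
  move=> ai k'; rewrite !cat_configE flip_compl !ffunE.
  case: eqVneq => [->|_]; first by rewrite aj ai.
  exact: lowfree ai k'.
Qed.

Lemma lift_net_two_steps n (f : config n -> config n) x z1 z2 :
  (forall i, ~ negative_loop f i) ->
  async (lift_net f) (diag x) z1 -> async (lift_net f) z1 z2 ->
  (exists2 y, async f x y & z2 = diag y) \/ (exists b, trapped b z2).
Proof.
move=> nl /asyncP[k fk ->]; move: fk; rewrite lift_net_diag.
have step i : f x i != x i ->
    [/\ async f x (flip x i), f (flip x i) i = f x i & f x i = flip x i i].
  move=> fx; split; first by apply/asyncP; exists i.
    exact: no_negative_loop_flip.
  by rewrite flip_at; case: (f x i) (x i) fx => [] [].
case: (split_ordP k) => i ->.
(* Here [flip x i] plays the role of [a] and [x] that of [c]; when the second copy moves first, the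
   roles are exchanged. *)
- rewrite !cat_configl flip_catl => fx; have [xy fE fv] := step i fx.
  case/(@lift_net_second_step _ f _ _ i) => [j ji||||tz].
  + exact: flip_off.
  + by rewrite -fv.
  + by [].
  + by rewrite fE fv eqxx => ->; left; exists (flip x i).
  + by right; exists (flip x i i).
- rewrite !cat_configr !ffunE flip_catr flip_compl => nfx.
  have fx : f x i != x i by case: (f x i) (x i) nfx => [] [].
  have [xy fE fv] := step i fx.
  case/(@lift_net_second_step _ f _ _ i) => [j ji||||tz].
  + by rewrite flip_off.
  + by rewrite -fv eq_sym.
  + by [].
  + by rewrite eq_sym (negPf fx) => ->; left; exists (flip x i).
  + by right; exists (x i).
Qed.

(** * Paths and their lifts of doubled length *)

Lemma lift_net_simulates_step n (f : config n -> config n) x y :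
  (forall i, ~ negative_loop f i) -> async f x y ->
  exists2 z, async (lift_net f) (diag x) z & async (lift_net f) z (diag y).
Proof.
move=> nl /asyncP[i fx ->]; exists (cat_config (flip x i) (compl_config x)).
  apply/asyncP; exists (lshift n i); last by rewrite flip_catl.
  by rewrite lift_net_lshift // cat_configl.
apply/asyncP; exists (rshift n i); last by rewrite flip_catr flip_compl.
(* The second half still encodes [x], so component n + i evaluates to [~~ f x i]. *)
rewrite lift_net_rshift; last exact: flip_off.
by rewrite cat_configr ffunE; case: (f x i) (x i) fx => [] [].
Qed.

Lemma diag_inj n : injective (@diag n).
Proof. by move=> x y /(congr1 (@lhalf n n)); rewrite !lhalf_cat. Qed.

Lemma lift_net_path n (f : config n -> config n) x y l :
  (forall i, ~ negative_loop f i) ->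
  has_path (async f) x y l <->
  has_path (async (lift_net f)) (diag x) (diag y) (2 * l).
Proof.
move=> nl; elim: l x => [|l IH] x.
  rewrite muln0; split=> -[p [_ + /size0nil p0]]; rewrite p0 /=.
    by move=> <-; exists [::].
  by move=> /diag_inj <-; exists [::].
rewrite mulnS; split.
  case=> -[|w p] [/= pp lp] // [sp]; case/andP: pp => xw wp.
  have [z xz zw] := lift_net_simulates_step nl xw.
  have /IH[q [wq lq sq]] : has_path (async f) w y l by exists p.
  by exists [:: z, diag w & q]; split=> //=; rewrite ?xz ?zw ?sq.
case=> -[|z1 [|z2 p]] [/= pp lp] // [sp].
case/and3P: pp => xz1 z12 zp.
case: (lift_net_two_steps nl xz1 z12) => [[w xw z2w]|[b tz]].
  have /IH[q [wq lq sq]] : has_path (async (lift_net f)) (diag w) (diag y) (2 * l).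
    by rewrite -z2w; exists p.
  by exists (w :: q); split=> //=; rewrite ?xw ?sq.
(* Trapping would persist up to [diag y]. The first arc provides the index that [trapped_diag]
   requires. *)
case/asyncP: xz1 => k _ _; have i : 'I_n by case: (split k).
by have := trapped_path tz zp; rewrite lp => /(trapped_diag i).
Qed.

Theorem theorem5 (n : nat) (f : config n -> config n)
    (hf : forall i : 'I_n, ~ negative_loop f i) :
  exists f' : config (n + n) -> config (n + n),
    [/\ monotone f',
        forall x : config n,
          f x = x <->
          f' (cat_config x (compl_config x)) = cat_config x (compl_config x)
      & forall (x y : config n) (l : nat),
          has_path (async f) x y l <->
          has_path (async f') (cat_config x (compl_config x))
            (cat_config y (compl_config y)) (2 * l)].
Proof.
exists (lift_net f); split=> [|x|x y l].
- exact: lift_net_monotone.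
- rewrite -/(diag x) lift_net_diag; split=> [-> //|]; exact: diag_inj.
- exact: lift_net_path.
Qed.
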